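(* Let $(\alpha_1,\alpha_2,\alpha_3)\in\mathbb R^3$ with $\alpha_1^2+\alpha_2^2+\alpha_3^2=1$, $\beta\in\mathbb R$, $t\in\mathbb R$, and put $$\mu_2=t,\quad\nu_2=t^2/2\quad\text{if }\beta^2=1-\alpha_2^2;$$ $$\mu_2=\frac{\sinh\left(t\sqrt{1-\alpha_2^2-\beta^2}\right)}{\sqrt{1-\alpha_2^2-\beta^2}},\quad \nu_2=\frac{\cosh\left(t\sqrt{1-\alpha_2^2-\beta^2}\right)-1}{1-\alpha_2^2-\beta^2}\quad\text{if }\beta^2<1-\alpha_2^2;$$ $$\mu_2=\frac{\sin\left(t\sqrt{\beta^2+\alpha_2^2-1}\right)}{\sqrt{\beta^2+\alpha_2^2-1}},\quad \nu_2=\frac{1-\cos\left(t\sqrt{\beta^2+\alpha_2^2-1}\right)}{\beta^2+\alpha_2^2-1}\quad\text{if }\beta^2>1-\alpha_2^2.$$ If $\alpha_2\ne\pm1$, then the geodesic $\gamma_2(\alpha_1,\alpha_2,\alpha_3,\beta;t)$, $t\in\mathbb R$, of the sub-Riemannian space $(SO_0(2,1)\times\mathbb R,\rho_2)$ is equal to $(C,v)(t)$, where $v(t)=\alpha_2t$ and the columns $C_j(t)$, $j=1,2,3$, of the matrix $C(t)\in SO_0(2,1)$ have the form $$C_1(t)=\begin{pmatrix}1+\nu_2(1-\alpha_2^2)\\ \sqrt{1-\alpha_2^2}\,(\mu_2\cos\varphi_0-\beta\nu_2\sin\varphi_0)\\ \sqrt{1-\alpha_2^2}\,(\mu_2\sin\varphi_0+\beta\nu_2\cos\varphi_0)\end{pmatrix},$$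 $$C_2(t)=\begin{pmatrix}\sqrt{1-\alpha_2^2}\,(\mu_2\cos(\beta t+\varphi_0)+\beta\nu_2\sin(\beta t+\varphi_0))\\ (1-\beta^2\nu_2)\cos\beta t+\beta\mu_2\sin\beta t+(1-\alpha_2^2)\nu_2\cos(\beta t+\varphi_0)\cos\varphi_0\\ -(1-\beta^2\nu_2)\sin\beta t+\beta\mu_2\cos\beta t+(1-\alpha_2^2)\nu_2\cos(\beta t+\varphi_0)\sin\varphi_0\end{pmatrix},$$ $$C_3(t)=\begin{pmatrix}\sqrt{1-\alpha_2^2}\,(\mu_2\sin(\beta t+\varphi_0)-\beta\nu_2\cos(\beta t+\varphi_0))\\ (1-\beta^2\nu_2)\sin\beta t-\beta\mu_2\cos\beta t+(1-\alpha_2^2)\nu_2\sin(\beta t+\varphi_0)\cos\varphi_0\\ (1-\beta^2\nu_2)\cos\beta t+\beta\mu_2\sin\beta t+(1-\alpha_2^2)\nu_2\sin(\beta t+\varphi_0)\sin\varphi_0\end{pmatrix},$$ where $\alpha_1=\sqrt{1-\alpha_2^2}\sin\varphi_0$, $\alpha_3=\sqrt{1-\alpha_2^2}\cos\varphi_0$. If $\alpha_2=\pm1$, then this geodesic is equal to $\gamma_2(t)=(E,v)(t)$, $t\in\mathbb R$, where $E$ is the identity $3\times3$ matrix and $v(t)=\alpha_2t$.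
   Context: $SO_0(2,1)=\{g\in GL(3,\mathbb R)\mid g^TJg=J,\ \det g=1,\ g_{11}>0\}$ with $J=\mathrm{diag}(-1,1,1)$. $SO_0(2,1)\times\mathbb R$ is the group of $4\times4$ block-diagonal matrices $(C,v):=\mathrm{diag}(C,e^v)$ with $C\in SO_0(2,1)$, $v\in\mathbb R$. Its Lie algebra has basis $E_1=e_{13}+e_{31}$, $E_2=e_{12}+e_{21}$, $E_3=e_{23}-e_{32}$, $E_4=e_{44}$ ($e_{ij}$ with double indices are $4\times4$ matrix units). Put $e_1=E_1$, $e_2=E_4$, $e_3=E_2$, $e_4=-E_3$. $\rho_2$ is the left-invariant sub-Riemannian metric defined by the left-invariant distribution with value $\mathrm{span}(e_1,e_2,e_3)$ at the unit $\mathrm{Id}$ and the inner product with orthonormal basis $e_1,e_2,e_3$. The arclength-parametrized geodesics of $\rho_2$ starting at $\mathrm{Id}$ are the curves $\gamma_2(\alpha_1,\alpha_2,\alpha_3,\beta;t)=\exp(t(\alpha_1e_1+\alpha_2e_2+\alpha_3e_3+\beta e_4))\exp(-t\beta e_4)$ with $\alpha_1^2+\alpha_2^2+\alpha_3^2=1$, $\beta\in\mathbb R$. *)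

(* Defs.v *)
From HB Require Import structures.
From mathcomp Require Import all_boot all_order all_algebra.
From mathcomp Require Import boolp classical_sets functions reals.
From mathcomp Require Import topology normedtype sequences exp trigo.

Set Implicit Arguments.
Unset Strict Implicit.
Unset Printing Implicit Defensive.

Import Order.TTheory GRing.Theory Num.Theory.
Import numFieldNormedType.Exports.

Local Open Scope classical_set_scope.
Local Open Scope ring_scope.

Definition sinh {R : realType} (x : R) : R := (expR x - expR (- x)) / 2.
Definition cosh {R : realType} (x : R) : R := (expR x + expR (- x)) / 2.

(* The limit is taken in the normed space of matrices; the series converges
   absolutely for every [A], so [lim] never takes its default value here. *)
Definition mexp {R : realType} {n : nat} (A : 'M[R]_n.+1) : 'M[R]_n.+1 :=
  lim (series (fun k : nat => (k`!%:R)^-1 *: A ^+ k) @ \oo).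

Definition J21 {R : realType} : 'M[R]_3 :=
  \matrix_(i < 3, j < 3) (if i == j then (if i == 0 then -1 else 1) else 0).

Definition SO21 {R : realType} : set 'M[R]_3 :=
  [set g : 'M[R]_3 | [/\ g^T *m J21 *m g = J21, \det g = 1 & 0 < g 0 0]].

(* The element [(C, v)] of $SO_0(2,1) \times \mathbb R$. *)
Definition blockCv {R : realType} (C : 'M[R]_3) (v : R) : 'M[R]_4 :=
  block_mx (C : 'M[R]_(3, 3)) (0 : 'M[R]_(3, 1))
           (0 : 'M[R]_(1, 3)) ((expR v)%:M : 'M[R]_(1, 1)).

(* Matrix indices start at 0, so that the matrix unit usually written
   $e_{ij}$ is [delta_mx (i - 1) (j - 1)]. *)
Definition E1 {R : realType} : 'M[R]_4 := delta_mx 0 2 + delta_mx 2 0.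
Definition E2 {R : realType} : 'M[R]_4 := delta_mx 0 1 + delta_mx 1 0.
Definition E3 {R : realType} : 'M[R]_4 := delta_mx 1 2 - delta_mx 2 1.
Definition E4 {R : realType} : 'M[R]_4 := delta_mx 3 3.

Definition e1 {R : realType} : 'M[R]_4 := E1.
Definition e2 {R : realType} : 'M[R]_4 := E4.
Definition e3 {R : realType} : 'M[R]_4 := E2.
Definition e4 {R : realType} : 'M[R]_4 := - E3.

(* For [alpha1 ^+ 2 + alpha2 ^+ 2 + alpha3 ^+ 2 = 1] these curves are exactly
   the arclength-parametrized geodesics starting at the unit of the
   left-invariant sub-Riemannian metric on $SO_0(2,1) \times \mathbb R$ for
   which [e1], [e2], [e3] is an orthonormal basis of the distribution. *)
Definition gamma2 {R : realType} (alpha1 alpha2 alpha3 beta t : R) : 'M[R]_4 :=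
  mexp (t *: (alpha1 *: e1 + alpha2 *: e2 + alpha3 *: e3 + beta *: e4))
  *m mexp (- (t * beta) *: e4).

Definition mu2 {R : realType} (alpha2 beta t : R) : R :=
  if beta ^+ 2 == 1 - alpha2 ^+ 2 then t
  else if beta ^+ 2 < 1 - alpha2 ^+ 2 then
    sinh (t * Num.sqrt (1 - alpha2 ^+ 2 - beta ^+ 2))
      / Num.sqrt (1 - alpha2 ^+ 2 - beta ^+ 2)
  else
    sin (t * Num.sqrt (beta ^+ 2 + alpha2 ^+ 2 - 1))
      / Num.sqrt (beta ^+ 2 + alpha2 ^+ 2 - 1).

Definition nu2 {R : realType} (alpha2 beta t : R) : R :=
  if beta ^+ 2 == 1 - alpha2 ^+ 2 then t ^+ 2 / 2
  else if beta ^+ 2 < 1 - alpha2 ^+ 2 then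
    (cosh (t * Num.sqrt (1 - alpha2 ^+ 2 - beta ^+ 2)) - 1)
      / (1 - alpha2 ^+ 2 - beta ^+ 2)
  else
    (1 - cos (t * Num.sqrt (beta ^+ 2 + alpha2 ^+ 2 - 1)))
      / (beta ^+ 2 + alpha2 ^+ 2 - 1).

Definition colvec3 {R : realType} (x y z : R) : 'cV[R]_3 :=
  \col_(i < 3) [:: x; y; z]`_i.

Definition C1 {R : realType} (alpha2 beta phi0 t : R) : 'cV[R]_3 :=
  let mu := mu2 alpha2 beta t in
  let nu := nu2 alpha2 beta t in
  colvec3
    (1 + nu * (1 - alpha2 ^+ 2))
    (Num.sqrt (1 - alpha2 ^+ 2) * (mu * cos phi0 - beta * nu * sin phi0))
    (Num.sqrt (1 - alpha2 ^+ 2) * (mu * sin phi0 + beta * nu * cos phi0)).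

Definition C2 {R : realType} (alpha2 beta phi0 t : R) : 'cV[R]_3 :=
  let mu := mu2 alpha2 beta t in
  let nu := nu2 alpha2 beta t in
  colvec3
    (Num.sqrt (1 - alpha2 ^+ 2)
       * (mu * cos (beta * t + phi0) + beta * nu * sin (beta * t + phi0)))
    ((1 - beta ^+ 2 * nu) * cos (beta * t) + beta * mu * sin (beta * t)
       + (1 - alpha2 ^+ 2) * nu * cos (beta * t + phi0) * cos phi0)
    (- (1 - beta ^+ 2 * nu) * sin (beta * t) + beta * mu * cos (beta * t)
       + (1 - alpha2 ^+ 2) * nu * cos (beta * t + phi0) * sin phi0).

Definition C3 {R : realType} (alpha2 beta phi0 t : R) : 'cV[R]_3 :=
  let mu := mu2 alpha2 beta t in
  let nu := nu2 alpha2 beta t in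
  colvec3
    (Num.sqrt (1 - alpha2 ^+ 2)
       * (mu * sin (beta * t + phi0) - beta * nu * cos (beta * t + phi0)))
    ((1 - beta ^+ 2 * nu) * sin (beta * t) - beta * mu * cos (beta * t)
       + (1 - alpha2 ^+ 2) * nu * sin (beta * t + phi0) * cos phi0)
    ((1 - beta ^+ 2 * nu) * cos (beta * t) + beta * mu * sin (beta * t)
       + (1 - alpha2 ^+ 2) * nu * sin (beta * t + phi0) * sin phi0).

Definition Cmx {R : realType} (alpha2 beta phi0 t : R) : 'M[R]_3 :=
  \matrix_(i < 3, j < 3)
    ([:: C1 alpha2 beta phi0 t; C2 alpha2 beta phi0 t;
         C3 alpha2 beta phi0 t]`_j) i 0.

(* Main.v *)
Require Import Defs.
From HB Require Import structures.
From mathcomp Require Import all_boot all_order all_algebra ring.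
From mathcomp Require Import boolp classical_sets functions reals.
From mathcomp Require Import topology normedtype sequences exp trigo.
Import Order.TTheory GRing.Theory Num.Theory.
Import numFieldNormedType.Exports.
Local Open Scope classical_set_scope.
Local Open Scope ring_scope.

(** Modulo its last diagonal entry, the generator
      t (alpha1 e1 + alpha2 e2 + alpha3 e3 + beta e4)
    of the geodesic is t A with A in so(2,1). The trace and the determinant of A
    vanish, so Cayley-Hamilton reads A^3 = kappa A, where
    kappa = alpha1^2 + alpha3^2 - beta^2 = 1 - alpha2^2 - beta^2. Every positive power of
    A is thus a multiple of A or of A^2, and summing the exponential series
    separately over odd and even exponents gives
      exp (t A) = 1 + mu A + nu A^2,
    where mu = sum kappa^j t^(2j+1) / (2j+1)! and
    nu = sum kappa^j t^(2j+2) / (2j+2)!. These two sums ([gsin] and [gver]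
    below) are the mu_2 and nu_2 of the theorem: hyperbolic, polynomial or
    trigonometric functions of t according to the sign of kappa ([cvg_gsin],
    [cvg_gver]). The direction e2 is an idempotent P of rank
    one with A P = P A = 0, so it only contributes the
    factor e^(alpha2 t) on its own line; [mexp_cubic] treats both parts at once.

    The second factor exp (- t beta e4) of the geodesic is the special case
    kappa = -1, where mu and nu are sin and 1 - cos: it is a rotation. The
    columns C_1, C_2, C_3 are then read off from the product of two explicit
    3 x 3 matrices, once (alpha3, alpha1) is written in polar coordinates and
    the addition formulas are applied to beta t + phi0 ([CmxE]).

    Membership in SO_0(2,1) rests on the identity mu^2 = 2 nu + kappa nu^2
    ([gsin_sqr]), the generalized cosh^2 - sinh^2 = 1. As A is antisymmetric for
    the form J, the J-adjoint of 1 + mu A + nu A^2 is 1 - mu A + nu A^2, and the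
    product of the two is 1 + (2 nu + kappa nu^2 - mu^2) A^2 = 1. The
    determinant is 1 for the same reason, and the corner entry is
    1 + nu (alpha1^2 + alpha3^2) > 0 because nu >= 0.

    When alpha2 = 1 or alpha2 = -1, both alpha1 and alpha3 vanish and the two
    exponentials are inverse rotations up to the dilation e^(alpha2 t). *)

(** * Generalized sine and versine *)

(** The solution of f'' = kappa f with f(0) = 0 and f'(0) = 1. *)
Definition gsin {R : realType} (kappa t : R) : R :=
  if kappa == 0 then t
  else if 0 < kappa then sinh (t * Num.sqrt kappa) / Num.sqrt kappa
  else sin (t * Num.sqrt (- kappa)) / Num.sqrt (- kappa).

(** The primitive of [gsin kappa] that vanishes at 0. *)
Definition gver {R : realType} (kappa t : R) : R :=
  if kappa == 0 then t ^+ 2 / 2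
  else if 0 < kappa then (cosh (t * Num.sqrt kappa) - 1) / kappa
  else (1 - cos (t * Num.sqrt (- kappa))) / - kappa.

(** The coefficient of A in (t A)^k / k! for odd k, when A^3 = kappa A. *)
Definition gsin_coeff {R : realType} (kappa t : R) (k : nat) : R :=
  (odd k)%:R * (kappa ^+ k./2 * exp_coeff t k).

(** The coefficient of A^2 in (t A)^k / k! for even k, when A^3 = kappa A. The
    exponent k = 0 is left out, since 1 need not be a multiple of A^2. *)
Definition gver_coeff {R : realType} (kappa t : R) (k : nat) : R :=
  ((k != 0%N) && ~~ odd k)%:R * (kappa ^+ (k./2).-1 * exp_coeff t k).

Lemma cvg_seriesD {R : realType} {V : normedModType R} (u v : nat -> V) (x y : V) :
  series u @ \oo --> x -> series v @ \oo --> y ->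
  series (fun k => u k + v k) @ \oo --> x + y.
Proof. by move=> ux vy; rewrite -[fun k => _]/(u + v) seriesD; exact: cvgD. Qed.

Lemma cvg_seriesZ {R : realType} {V : normedModType R} (a : nat -> R) (l : R) (X : V) :
  series a @ \oo --> l -> series (fun k => a k *: X) @ \oo --> l *: X.
Proof.
move=> al.
have -> : series (fun k => a k *: X) = fun n => series a n *: X.
  by apply/funext => n; rewrite /series /= scaler_suml.
exact: cvgZr_tmp.
Qed.

Lemma cvg_series_mul {R : realType} (a : nat -> R) (l c : R) :
  series a @ \oo --> l -> series (fun k => a k * c) @ \oo --> l * c.
Proof. exact: (@cvg_seriesZ R R^o). Qed.

Lemma cvg_series_unit {R : realType} (m : nat) :
  series (fun k => (k == m)%:R : R) @ \oo --> (1 : R).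
Proof.
rewrite -(@cvg_shiftn m.+1 R^o).
rewrite [X in X @ _ --> _](_ : _ = fun=> 1); first exact: cvg_cst.
apply/funext => n; rewrite /series /= big_mkord.
have mn : (m < n + m.+1)%N by rewrite addnS ltnS leq_addl.
rewrite (bigD1 (Ordinal mn)) //= eqxx big1 ?addr0// => i /negPf im.
by rewrite -val_eqE /= in im; rewrite im.
Qed.

Lemma cvg_expR_series {R : realType} (x : R) : series (exp_coeff x) @ \oo --> expR x.
Proof. exact: is_cvg_series_exp_coeff. Qed.

Lemma cvg_sin_series {R : realType} (x : R) : series (sin_coeff x) @ \oo --> sin x.
Proof. by rewrite unlock; exact: is_cvg_series_sin_coeff. Qed.

Lemma cvg_cos_series {R : realType} (x : R) : series (cos_coeff x) @ \oo --> cos x.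
Proof. by rewrite unlock; exact: is_cvg_series_cos_coeff. Qed.

(** For kappa > 0 (resp. kappa < 0) the power kappa^j is w^(2j) (resp.
    (-1)^j w^(2j)) with w^2 = |kappa|, so up to the factor 1 / w the series is
    that of sinh (resp. sin) at t w; for kappa = 0 only the term t survives. *)
Lemma cvg_gsin {R : realType} (kappa t : R) :
  series (gsin_coeff kappa t) @ \oo --> gsin kappa t.
Proof.
rewrite /gsin; case: eqVneq => [->|kappa0].
  have -> : gsin_coeff 0 t = fun k => (k == 1%N)%:R * t.
    apply/funext => k; rewrite /gsin_coeff /exp_coeff /=.
    case: k => [|[|k]]; rewrite /= ?mul0r// ?expr0 ?expr1 ?divr1 ?mul1r//.
    by rewrite expr0n /= !mul0r mulr0.
  by rewrite -[X in _ --> X]mul1r; apply: cvg_series_mul; exact: cvg_series_unit.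
case: ltP => [kappa_gt0|kappa_le0].
  set w := Num.sqrt kappa.
  have w0 : w != 0 by rewrite sqrtr_eq0 -ltNge.
  have -> : gsin_coeff kappa t = fun k =>
      (exp_coeff (t * w) k + exp_coeff (- (t * w)) k * -1) * (2^-1 / w).
    apply/funext => k; rewrite /gsin_coeff /exp_coeff /=.
    rewrite exprNn !exprMn -signr_odd -(sqr_sqrtr (ltW kappa_gt0)) -/w.
    rewrite -exprM mul2n -[in w ^+ k](odd_double_half k) exprD.
    case: (odd k) => /=; last by ring.
    by rewrite expr1; field; rewrite w0 pnatr_eq0 -lt0n fact_gt0.
  have -> : sinh (t * w) / w
      = (expR (t * w) + expR (- (t * w)) * -1) * (2^-1 / w).
    by rewrite /sinh; field.
  apply: cvg_series_mul; apply: cvg_seriesD; first exact: cvg_expR_series.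
  by apply: cvg_series_mul; exact: cvg_expR_series.
have kappa_ge0 : 0 <= - kappa by rewrite oppr_ge0.
set w := Num.sqrt (- kappa).
have w0 : w != 0 by rewrite sqrtr_eq0 -ltNge oppr_gt0 lt_neqAle kappa0.
have -> : gsin_coeff kappa t = fun k => sin_coeff (t * w) k * w^-1.
  apply/funext => k; rewrite /gsin_coeff /exp_coeff /sin_coeff /=.
  rewrite exprMn -[kappa]opprK -(sqr_sqrtr kappa_ge0) -/w.
  rewrite (exprNn (w ^+ 2)) -exprM mul2n -[in w ^+ k](odd_double_half k) exprD.
  have [|_] := boolP (odd k); last by rewrite !mul0r.
  case: k => [//|k] /= ok; rewrite uphalf_half (negPf ok) add0n expr1.
  by field; rewrite w0 pnatr_eq0 -lt0n fact_gt0.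
by apply: cvg_series_mul; exact: cvg_sin_series.
Qed.

(** As for [cvg_gsin], but the exponent of kappa lags one step behind that of
    t^2: the series is that of cosh - 1 (resp. 1 - cos) divided by |kappa|. *)
Lemma cvg_gver {R : realType} (kappa t : R) :
  series (gver_coeff kappa t) @ \oo --> gver kappa t.
Proof.
rewrite /gver; case: eqVneq => [->|kappa0].
  have -> : gver_coeff 0 t = fun k => (k == 2%N)%:R * (t ^+ 2 / 2).
    apply/funext => k; rewrite /gver_coeff /exp_coeff /=.
    case: k => [|[|[|k]]]; rewrite /= ?mul0r// ?expr0 ?mul1r//.
    case: k => [|k]; rewrite /= ?mul0r//.
    by rewrite expr0n /= !mul0r mulr0.
  by rewrite -[X in _ --> X]mul1r; apply: cvg_series_mul; exact: cvg_series_unit.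
case: ltP => [kappa_gt0|kappa_le0].
  have -> : gver_coeff kappa t = fun k =>
      (exp_coeff (t * Num.sqrt kappa) k * 2^-1
       + exp_coeff (- (t * Num.sqrt kappa)) k * 2^-1
       + (k == 0%N)%:R * -1) * kappa^-1.
    apply/funext => k; rewrite /gver_coeff /exp_coeff /=.
    rewrite exprNn !exprMn -signr_odd -[in Num.sqrt _ ^+ k](odd_double_half k).
    rewrite exprD -mul2n (exprM _ 2) (sqr_sqrtr (ltW kappa_gt0)).
    have [ok|ek] := boolP (odd k).
      have -> : (k == 0%N) = false by case: k ok.
      by rewrite /=; ring.
    have [->|k0] := eqVneq k 0%N; first by rewrite /= !expr0 fact0; field.
    have -> : k./2 = (k./2).-1.+1 by case: k ek k0 => [|[|k]].
    by rewrite !expr0 exprS /=; field; rewrite kappa0 pnatr_eq0 -lt0n fact_gt0.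
  have -> : (cosh (t * Num.sqrt kappa) - 1) / kappa
      = (expR (t * Num.sqrt kappa) * 2^-1 + expR (- (t * Num.sqrt kappa)) * 2^-1
         + 1 * -1) * kappa^-1.
    by rewrite /cosh; field.
  apply: cvg_series_mul; apply: cvg_seriesD; last first.
    by apply: cvg_series_mul; exact: cvg_series_unit.
  by apply: cvg_seriesD; apply: cvg_series_mul; exact: cvg_expR_series.
have kappa_ge0 : 0 <= - kappa by rewrite oppr_ge0.
have -> : gver_coeff kappa t = fun k =>
    ((k == 0%N)%:R + cos_coeff (t * Num.sqrt (- kappa)) k * -1) * (- kappa)^-1.
  apply/funext => k; rewrite /gver_coeff /exp_coeff /cos_coeff /=.
  rewrite -[in Num.sqrt _](opprK kappa).
  rewrite exprMn -[in Num.sqrt _ ^+ k](odd_double_half k).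
  rewrite exprD -mul2n (exprM _ 2) opprK (sqr_sqrtr kappa_ge0).
  have [ok|ek] := boolP (odd k).
    have -> : (k == 0%N) = false by case: k ok.
    by rewrite /=; ring.
  have [->|k0] := eqVneq k 0%N; first by rewrite /= !expr0 fact0; field.
  have -> : k./2 = (k./2).-1.+1 by case: k ek k0 => [|[|k]].
  rewrite /= -exprnP !exprS (exprNn kappa).
  (* Multiply by ((-1)^j)^2 = 1 to match the signs of the cosine series. *)
  rewrite expr0 -[LHS]mul1r -{1}(signrMK (k./2).-1 1).
  by field; rewrite kappa0 pnatr_eq0 -lt0n fact_gt0.
apply: cvg_series_mul; apply: cvg_seriesD; first exact: cvg_series_unit.
have -> : - cos (t * Num.sqrt (- kappa)) = cos (t * Num.sqrt (- kappa)) * -1.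
  by rewrite mulrN1.
by apply: cvg_series_mul; exact: cvg_cos_series.
Qed.

(** With x = e^(t sqrt kappa), cosh - 1 is (x - 1)^2 / (2 x). *)
Lemma gver_ge0 {R : realType} (kappa t : R) : 0 <= gver kappa t.
Proof.
rewrite /gver; case: eqVneq => [_|kappa0]; first by rewrite divr_ge0 ?sqr_ge0.
case: ltP => [kappa_gt0|kappa_le0].
  apply: divr_ge0; last exact: ltW.
  rewrite /cosh expRN; set x := expR _.
  have x0 : 0 < x by exact: expR_gt0.
  have -> : (x + x^-1) / 2 - 1 = (x - 1) ^+ 2 / (x * 2).
    by field; rewrite lt0r_neq0.
  by rewrite divr_ge0 ?sqr_ge0 ?mulr_ge0 ?ltW.
by rewrite divr_ge0 ?oppr_ge0// subr_ge0 cos_le1.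
Qed.

(** The Pythagorean identity c^2 - kappa mu^2 = 1 with c = 1 + kappa nu, divided
    by kappa so that it survives at kappa = 0. *)
Lemma gsin_sqr {R : realType} (kappa t : R) :
  gsin kappa t ^+ 2 = 2 * gver kappa t + kappa * gver kappa t ^+ 2.
Proof.
rewrite /gsin /gver; case: eqVneq => [->|kappa0]; first by field.
case: ltP => [kappa_gt0|kappa_le0].
  rewrite exprMn exprVn sqr_sqrtr ?ltW// /sinh /cosh expRN.
  have := lt0r_neq0 (expR_gt0 (t * Num.sqrt kappa)).
  by move: (expR _) => x x0; field; rewrite x0 kappa0.
rewrite exprMn exprVn sqr_sqrtr ?oppr_ge0// sin2cos2.
by field.
Qed.

Lemma gsinN1 {R : realType} (s : R) : gsin (-1) s = sin s.
Proof.
by rewrite /gsin oppr_eq0 oner_eq0 ltr0N1 opprK sqrtr1 mulr1 divr1.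
Qed.

Lemma gverN1 {R : realType} (s : R) : gver (-1) s = 1 - cos s.
Proof.
by rewrite /gver oppr_eq0 oner_eq0 ltr0N1 opprK sqrtr1 mulr1 divr1.
Qed.

Lemma mu2E {R : realType} (alpha2 beta t : R) :
  mu2 alpha2 beta t = gsin (1 - alpha2 ^+ 2 - beta ^+ 2) t.
Proof.
rewrite /mu2 /gsin subr_eq0 eq_sym subr_gt0.
by have -> : beta ^+ 2 + alpha2 ^+ 2 - 1 = - (1 - alpha2 ^+ 2 - beta ^+ 2) by ring.
Qed.

Lemma nu2E {R : realType} (alpha2 beta t : R) :
  nu2 alpha2 beta t = gver (1 - alpha2 ^+ 2 - beta ^+ 2) t.
Proof.
rewrite /nu2 /gver subr_eq0 eq_sym subr_gt0.
by have -> : beta ^+ 2 + alpha2 ^+ 2 - 1 = - (1 - alpha2 ^+ 2 - beta ^+ 2) by ring.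
Qed.

(** * Exponential of a matrix annihilated by a cubic polynomial *)

(** Since A and P annihilate each other, (t A + c P)^k = t^k A^k + c^k P for
    k > 0. The k = 0 term 1 is split as (1 - P) + P, so that P collects the whole
    exponential series of c and 1 - P only the constant term. *)
Lemma mexp_cubic {R : realType} {n : nat} (A P : 'M[R]_n.+1) (kappa t c : R) :
  A ^+ 3 = kappa *: A -> P * P = P -> A * P = 0 -> P * A = 0 ->
  mexp (t *: A + c *: P)
  = 1 - P + expR c *: P + gsin kappa t *: A + gver kappa t *: A ^+ 2.
Proof.
move=> A3 PP AP PA.
have A_odd j : A ^+ j.*2.+1 = kappa ^+ j *: A.
  elim: j => [|j IH]; first by rewrite expr1 expr0 scale1r.
  by rewrite doubleS -add2n exprD IH -scalerAr -exprSr A3 scalerA -exprSr.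
have A_even j : A ^+ j.*2.+2 = kappa ^+ j *: A ^+ 2.
  by rewrite exprS A_odd -scalerAr -expr2.
have pow_split k :
    (t *: A + c *: P) ^+ k.+1 = t ^+ k.+1 *: A ^+ k.+1 + c ^+ k.+1 *: P.
  elim: k => [|k IH]; first by rewrite !expr1.
  have PAk : P * A ^+ k.+1 = 0 by rewrite exprS mulrA PA mul0r.
  rewrite exprS IH mulrDl !mulrDr -!scalerAl -!scalerAr AP PAk PP !scaler0.
  by rewrite addr0 add0r !scalerA -!exprS.
have termE k : (k`!%:R)^-1 *: (t *: A + c *: P) ^+ k =
    (k == 0%N)%:R *: (1 - P) + exp_coeff c k *: P
    + gsin_coeff kappa t k *: A + gver_coeff kappa t k *: A ^+ 2.
  rewrite /gsin_coeff /gver_coeff /exp_coeff /=; case: k => [|k].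
    by rewrite !expr0 fact0 divr1 invr1 !mul0r !scale0r !scale1r !addr0 subrK.
  rewrite pow_split scale0r add0r scalerDr !scalerA addrC -addrA.
  congr (_ + _); first by rewrite mulrC.
  rewrite -[in A ^+ k.+1](odd_double_half k.+1) /=.
  (* The exponent is k + 1: k odd feeds the A^2 series, k even the A series. *)
  have [ok|ek] := boolP (odd k); rewrite /=.
    rewrite mul0r scale0r add0r mul1r.
    have -> : uphalf k = (uphalf k).-1.+1 by case: k ok.
    by rewrite add0n A_even scalerA /=; congr (_ *: _); ring.
  by rewrite mul0r scale0r addr0 mul1r add1n A_odd scalerA; congr (_ *: _); ring.
rewrite /mexp; apply: cvg_lim => //.
rewrite (funext termE).
apply: cvg_seriesD; last by apply: cvg_seriesZ; exact: cvg_gver.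
apply: cvg_seriesD; last by apply: cvg_seriesZ; exact: cvg_gsin.
apply: cvg_seriesD; last by apply: cvg_seriesZ; exact: cvg_expR_series.
by rewrite -[X in _ --> X]scale1r; apply: cvg_seriesZ; exact: cvg_series_unit.
Qed.

(** * Quadratic polynomials in an element of so(2,1) *)

Definition mx3 {R : realType} (a b c d e f g h i : R) : 'M[R]_3 :=
  \matrix_(k < 3, l < 3)
    nth 0 (nth [::] [:: [:: a; b; c]; [:: d; e; f]; [:: g; h; i]] k) l.

Ltac mx3_entries :=
  apply/matrixP => -[[|[|[|//]]] ?] -[[|[|[|//]]] ?];
  rewrite !mxE ?big_ord_recl ?big_ord0 /= ?mxE /bump /=.

Lemma mx3_mul {R : realType} (a b c d e f g h i a' b' c' d' e' f' g' h' i' : R) :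
  mx3 a b c d e f g h i *m mx3 a' b' c' d' e' f' g' h' i' =
  mx3 (a * a' + b * d' + c * g') (a * b' + b * e' + c * h')
      (a * c' + b * f' + c * i')
      (d * a' + e * d' + f * g') (d * b' + e * e' + f * h')
      (d * c' + e * f' + f * i')
      (g * a' + h * d' + i * g') (g * b' + h * e' + i * h')
      (g * c' + h * f' + i * i').
Proof. by mx3_entries; ring. Qed.

Lemma det_mx3 {R : realType} (a b c d e f g h i : R) :
  \det (mx3 a b c d e f g h i) =
  a * (e * i - f * h) - b * (d * i - f * g) + c * (d * h - e * g).
Proof.
rewrite (expand_det_row _ 0) !big_ord_recl big_ord0 /cofactor.
rewrite !(expand_det_row _ 0) !big_ord_recl !big_ord0 /cofactor !det_mx11.
rewrite !mxE /= /bump /=; ring.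
Qed.

(** The upper left 3 x 3 block of alpha1 e1 + alpha3 e3 + beta e4. *)
Definition so21 {R : realType} (alpha1 alpha3 beta : R) : 'M[R]_3 :=
  mx3 0 alpha3 alpha1 alpha3 0 (- beta) alpha1 beta 0.

(** The shape taken by the exponential of a multiple of [so21 alpha1 alpha3 beta];
    keeping mu and nu free separates the algebra from the transcendental
    functions. *)
Definition quad_exp {R : realType} (alpha1 alpha3 beta mu nu : R) : 'M[R]_3 :=
  1 + mu *: so21 alpha1 alpha3 beta + nu *: so21 alpha1 alpha3 beta ^+ 2.

(** Cayley-Hamilton for a matrix with vanishing trace and determinant. *)
Lemma so21_cubed {R : realType} (alpha1 alpha3 beta : R) :
  so21 alpha1 alpha3 beta ^+ 3
  = (alpha1 ^+ 2 + alpha3 ^+ 2 - beta ^+ 2) *: so21 alpha1 alpha3 beta.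
Proof. by rewrite !exprS expr0 mulr1 -!mulmxE !mx3_mul; mx3_entries; ring. Qed.

Lemma quad_expE {R : realType} (a c b mu nu : R) :
  quad_exp a c b mu nu =
  mx3 (1 + nu * (a ^+ 2 + c ^+ 2)) (mu * c + nu * a * b) (mu * a - nu * b * c)
      (mu * c - nu * a * b) (1 + nu * (c ^+ 2 - b ^+ 2)) (- mu * b + nu * a * c)
      (mu * a + nu * b * c) (mu * b + nu * a * c) (1 + nu * (a ^+ 2 - b ^+ 2)).
Proof. by rewrite /quad_exp expr2 -mulmxE mx3_mul; mx3_entries; ring. Qed.

(** [so21 0 0 1] generates the rotations of the last two coordinates. *)
Lemma quad_exp_rot {R : realType} (s : R) :
  quad_exp 0 0 1 (gsin (-1) s) (gver (-1) s)
  = mx3 1 0 0 0 (cos s) (- sin s) 0 (sin s) (cos s).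
Proof. by rewrite quad_expE gsinN1 gverN1; mx3_entries; ring. Qed.

(** An element A of so(2,1) satisfies A^T J = - J A, and the sign disappears in
    A^2: transposition across J only changes the sign of mu. *)
Lemma quad_exp_J {R : realType} (a c b mu nu : R) :
  (quad_exp a c b mu nu)^T *m J21 = J21 *m quad_exp a c b (- mu) nu.
Proof. by rewrite !quad_expE; mx3_entries; ring. Qed.

(** The hypothesis on mu and nu is [gsin_sqr]; expanding with A^4 = kappa A^2
    leaves 1 plus a multiple of A^2 by the difference of its two sides. *)
Lemma quad_exp_mulN {R : realType} (a c b mu nu : R) :
  mu ^+ 2 = 2 * nu + (a ^+ 2 + c ^+ 2 - b ^+ 2) * nu ^+ 2 ->
  quad_exp a c b (- mu) nu *m quad_exp a c b mu nu = 1%:M.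
Proof.
move=> mu_sqr.
have -> : quad_exp a c b (- mu) nu *m quad_exp a c b mu nu =
    1%:M + (2 * nu + (a ^+ 2 + c ^+ 2 - b ^+ 2) * nu ^+ 2 - mu ^+ 2)
             *: so21 a c b ^+ 2.
  rewrite !quad_expE !expr2 -mulmxE !mx3_mul; mx3_entries; ring.
by rewrite mu_sqr subrr scale0r addr0.
Qed.

(** The eigenvalues are 1 and 1 + kappa nu +- sqrt kappa mu, so the determinant is
    (1 + kappa nu)^2 - kappa mu^2. *)
Lemma det_quad_exp {R : realType} (a c b mu nu : R) :
  mu ^+ 2 = 2 * nu + (a ^+ 2 + c ^+ 2 - b ^+ 2) * nu ^+ 2 ->
  \det (quad_exp a c b mu nu) = 1.
Proof.
move=> mu_sqr; rewrite quad_expE det_mx3.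
transitivity (1 + (a ^+ 2 + c ^+ 2 - b ^+ 2)
  * (2 * nu + (a ^+ 2 + c ^+ 2 - b ^+ 2) * nu ^+ 2 - mu ^+ 2)); first by ring.
by rewrite mu_sqr subrr mulr0 addr0.
Qed.

Lemma quad_exp_isom {R : realType} (a c b mu nu : R) :
  mu ^+ 2 = 2 * nu + (a ^+ 2 + c ^+ 2 - b ^+ 2) * nu ^+ 2 ->
  (quad_exp a c b mu nu)^T *m J21 *m quad_exp a c b mu nu = J21.
Proof. by move=> h; rewrite quad_exp_J -mulmxA quad_exp_mulN// mulmx1. Qed.

(** The SO_0(2,1)-component of the geodesic: exp (t A) followed by the rotation
    exp (- t beta e4). *)
Definition geodesic3 {R : realType} (a c b t : R) : 'M[R]_3 :=
  quad_exp a c b (gsin (a ^+ 2 + c ^+ 2 - b ^+ 2) t)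
                 (gver (a ^+ 2 + c ^+ 2 - b ^+ 2) t)
  *m quad_exp 0 0 1 (gsin (-1) (- (t * b))) (gver (-1) (- (t * b))).

(** The rotation fixes the first basis vector, so the corner entry is that of the
    first factor alone. *)
Lemma geodesic3_in_SO21 {R : realType} (a c b t : R) : SO21 (geodesic3 a c b t).
Proof.
set kappa := a ^+ 2 + c ^+ 2 - b ^+ 2.
have expP := gsin_sqr kappa t.
have rotP : gsin (-1) (- (t * b)) ^+ 2 = 2 * gver (-1) (- (t * b))
    + (0 ^+ 2 + 0 ^+ 2 - 1 ^+ 2) * gver (-1) (- (t * b)) ^+ 2.
  by rewrite gsin_sqr !expr2; ring.
split; rewrite /geodesic3 -/kappa.
- rewrite trmx_mul -!mulmxA (mulmxA J21) (mulmxA _ (J21 *m _)) (mulmxA _ J21).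
  by rewrite quad_exp_isom// mulmxA quad_exp_isom.
- by rewrite det_mulmx !det_quad_exp ?mulr1.
- rewrite quad_exp_rot quad_expE mx3_mul mxE /= !(mulr0, mulr1, addr0).
  by rewrite ltr_pwDl// mulr_ge0 ?gver_ge0// addr_ge0 ?sqr_ge0.
Qed.

(** * Passing to 4 x 4 block matrices *)

Definition hyp_block {R : realType} (X : 'M[R]_3) : 'M[R]_4 :=
  block_mx (X : 'M[R]_(3, 3)) (0 : 'M[R]_(3, 1)) (0 : 'M[R]_(1, 3)) (0 : 'M[R]_1).

Definition dil_block {R : realType} : 'M[R]_4 :=
  block_mx (0 : 'M[R]_(3, 3)) (0 : 'M[R]_(3, 1)) (0 : 'M[R]_(1, 3)) (1%:M : 'M[R]_1).

(** The block decomposition must be taken on 'M_(3 + 1): unification does not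
    recover 3 + 1 from the convertible 4. *)
Lemma eq_block41 {R : realType} (A : 'M[R]_(3 + 1)) X Y Z W :
  ulsubmx A = X -> ursubmx A = Y -> dlsubmx A = Z -> drsubmx A = W ->
  A = block_mx X Y Z W.
Proof. by move=> <- <- <- <-; rewrite submxK. Qed.

Lemma E4_block {R : realType} : @E4 R = dil_block.
Proof.
apply: eq_block41; apply/matrixP.
- by move=> -[[|[|[|//]]] ?] -[[|[|[|//]]] ?]; rewrite !mxE.
- by move=> -[[|[|[|//]]] ?] j; rewrite !ord1 !mxE.
- by move=> i -[[|[|[|//]]] ?]; rewrite !ord1 !mxE.
- by move=> i j; rewrite !ord1 !mxE.
Qed.

Lemma horizontal_block {R : realType} (alpha1 alpha3 beta : R) :
  alpha1 *: e1 + alpha3 *: e3 + beta *: e4 = hyp_block (so21 alpha1 alpha3 beta).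
Proof.
apply: eq_block41; apply/matrixP.
- by move=> -[[|[|[|//]]] ?] -[[|[|[|//]]] ?]; rewrite !mxE /=; ring.
- by move=> -[[|[|[|//]]] ?] j; rewrite !ord1 !mxE /=; ring.
- by move=> i -[[|[|[|//]]] ?]; rewrite !ord1 !mxE /=; ring.
- by move=> i j; rewrite !ord1 !mxE /=; ring.
Qed.

Lemma hyp_block_mul {R : realType} (X Y : 'M[R]_3) :
  hyp_block X * hyp_block Y = hyp_block (X *m Y).
Proof.
by rewrite /hyp_block -mulmxE (@mulmx_block _ 3 1 3 1 3 1) !(mulmx0, mul0mx, addr0).
Qed.

Lemma mexp_block {R : realType} (X : 'M[R]_3) (kappa t c : R) :
  X ^+ 3 = kappa *: X ->
  mexp (t *: hyp_block X + c *: dil_block)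
  = blockCv (1 + gsin kappa t *: X + gver kappa t *: X ^+ 2) c.
Proof.
move=> X3.
have sqrE : hyp_block X ^+ 2 = hyp_block (X ^+ 2) by rewrite expr2 hyp_block_mul.
rewrite (@mexp_cubic _ _ _ _ kappa).
- rewrite sqrE /hyp_block /dil_block /blockCv.
  have -> : (1 : 'M[R]_4) = block_mx (1%:M : 'M[R]_(3, 3)) (0 : 'M[R]_(3, 1))
              (0 : 'M[R]_(1, 3)) (1%:M : 'M[R]_1).
    exact: (@scalar_mx_block _ 3 1).
  rewrite (@opp_block_mx _ 3 1 3 1) !(@scale_block_mx _ 3 1 3 1).
  rewrite !(@add_block_mx _ 3 1 3 1).
  rewrite !(scaler0, addr0, subr0, oppr0, subrr, add0r).
  by rewrite scale_scalar_mx mulr1.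
- rewrite exprS sqrE hyp_block_mul mulmxE -exprS X3.
  by rewrite /hyp_block (@scale_block_mx _ 3 1 3 1) !scaler0.
- rewrite /dil_block -mulmxE (@mulmx_block _ 3 1 3 1 3 1).
  by rewrite !(mulmx0, mul0mx, addr0, add0r, mulmx1).
- rewrite /hyp_block /dil_block -mulmxE (@mulmx_block _ 3 1 3 1 3 1).
  by rewrite !(mulmx0, mul0mx, addr0, add0r) /block_mx !row_mx0 col_mx0.
- rewrite /hyp_block /dil_block -mulmxE (@mulmx_block _ 3 1 3 1 3 1).
  by rewrite !(mulmx0, mul0mx, addr0, add0r) /block_mx !row_mx0 col_mx0.
Qed.

Lemma blockCv_mul {R : realType} (C C' : 'M[R]_3) (v v' : R) :
  blockCv C v *m blockCv C' v' = blockCv (C *m C') (v + v').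
Proof.
rewrite /blockCv.
rewrite (@mulmx_block _ 3 1 3 1 3 1) !(mulmx0, mul0mx, addr0, add0r).
by rewrite -scalar_mxM expRD.
Qed.

(** * The geodesic *)

Lemma mexp_so21 {R : realType} (a b c t d : R) (kappa := a ^+ 2 + c ^+ 2 - b ^+ 2) :
  mexp (t *: (a *: e1 + c *: e3 + b *: e4) + d *: e2)
  = blockCv (quad_exp a c b (gsin kappa t) (gver kappa t)) d.
Proof.
rewrite horizontal_block /e2 E4_block (@mexp_block _ _ kappa) //.
exact: so21_cubed.
Qed.

Lemma mexp_e4 {R : realType} (s : R) :
  mexp (s *: e4) = blockCv (quad_exp 0 0 1 (gsin (-1) s) (gver (-1) s)) 0.
Proof.
have -> : (-1 : R) = 0 ^+ 2 + 0 ^+ 2 - 1 ^+ 2 by ring.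
by rewrite -mexp_so21 !scale0r scale1r add0r addr0 add0r.
Qed.

Lemma gamma2E {R : realType} (a d c b t : R) :
  gamma2 a d c b t = blockCv (geodesic3 a c b t) (d * t).
Proof.
rewrite /gamma2 mexp_e4.
have -> : t *: (a *: e1 + d *: e2 + c *: e3 + b *: e4)
    = t *: (a *: e1 + c *: e3 + b *: e4) + (d * t) *: e2.
  by rewrite 2!(addrAC _ (d *: e2)) scalerDr scalerA (mulrC d).
by rewrite mexp_so21 blockCv_mul addr0.
Qed.

(** With (alpha3, alpha1) = s (cos phi0, sin phi0) and s^2 = 1 - alpha2^2, the
    entries agree after expanding cos and sin of beta t + phi0. *)
Lemma CmxE {R : realType} (alpha1 alpha2 alpha3 beta phi0 t : R) :
  alpha1 ^+ 2 + alpha2 ^+ 2 + alpha3 ^+ 2 = 1 ->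
  alpha1 = Num.sqrt (1 - alpha2 ^+ 2) * sin phi0 ->
  alpha3 = Num.sqrt (1 - alpha2 ^+ 2) * cos phi0 ->
  Cmx alpha2 beta phi0 t = geodesic3 alpha1 alpha3 beta t.
Proof.
move=> unit a1E a3E.
have horE : alpha1 ^+ 2 + alpha3 ^+ 2 = 1 - alpha2 ^+ 2 by rewrite -unit; ring.
have hor_ge0 : 0 <= 1 - alpha2 ^+ 2 by rewrite -horE addr_ge0 ?sqr_ge0.
rewrite /geodesic3 quad_exp_rot quad_expE mx3_mul /Cmx /C1 /C2 /C3 mu2E nu2E horE.
move: (gsin _ _) (gver _ _) => mu nu.
rewrite sinN cosN opprK a1E a3E (mulrC t) sinD cosD.
move: (sqr_sqrtr hor_ge0); move: (Num.sqrt _) => s <-.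
mx3_entries; rewrite ?mxE /=; ring.
Qed.

(** The angle is acos (x / r) up to a sign, which is that of y. *)
Lemma polar_coordinates {R : realType} (x y : R) :
  exists phi : R, y = Num.sqrt (x ^+ 2 + y ^+ 2) * sin phi
               /\ x = Num.sqrt (x ^+ 2 + y ^+ 2) * cos phi.
Proof.
set r := Num.sqrt _.
have r2 : r ^+ 2 = x ^+ 2 + y ^+ 2 by rewrite sqr_sqrtr ?addr_ge0 ?sqr_ge0.
have [r0|r_neq0] := eqVneq r 0.
  have /eqP : x ^+ 2 + y ^+ 2 = 0 by rewrite -r2 r0 expr0n.
  rewrite paddr_eq0 ?sqr_ge0// !sqrf_eq0 => /andP[/eqP -> /eqP ->].
  by exists 0; rewrite r0 !mul0r.
have r_gt0 : 0 < r by rewrite lt0r r_neq0 sqrtr_ge0.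
have xr_bound : -1 <= x / r <= 1.
  rewrite -ler_norml -sqrtr_sqr -[leRHS]sqrtr1 ler_sqrt ?ltr01//.
  by rewrite expr_div_n ler_pdivrMr ?exprn_gt0// mul1r r2 lerDl sqr_ge0.
have sin_abs : sin (acos (x / r)) = `|y| / r.
  rewrite sin_acos//; have -> : 1 - (x / r) ^+ 2 = (y / r) ^+ 2.
    have -> : 1 - (x / r) ^+ 2 = (r ^+ 2 - x ^+ 2) / r ^+ 2 by field.
    by rewrite r2 addrAC subrr add0r -r2 expr_div_n.
  by rewrite sqrtr_sqr normrM normfV (gtr0_norm r_gt0).
have cosE : r * cos (acos (x / r)) = x by rewrite acosK ?in_itv//= mulrC divfK.
have [y_ge0|y_lt0] := leP 0 y.
  by exists (acos (x / r)); rewrite sin_abs ger0_norm// mulrC divfK.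
exists (- acos (x / r)); rewrite sinN cosN sin_abs ltr0_norm// cosE.
by rewrite mulNr opprK mulrC divfK.
Qed.

Theorem theorem8 (R : realType) (alpha1 alpha2 alpha3 beta : R)
    (Halpha : alpha1 ^+ 2 + alpha2 ^+ 2 + alpha3 ^+ 2 = 1) :
  (alpha2 <> 1 /\ alpha2 <> -1 ->
     (exists phi0 : R,
        alpha1 = Num.sqrt (1 - alpha2 ^+ 2) * sin phi0 /\
        alpha3 = Num.sqrt (1 - alpha2 ^+ 2) * cos phi0) /\
     (forall phi0 : R,
        alpha1 = Num.sqrt (1 - alpha2 ^+ 2) * sin phi0 ->
        alpha3 = Num.sqrt (1 - alpha2 ^+ 2) * cos phi0 ->
        forall t : R,
          SO21 (Cmx alpha2 beta phi0 t) /\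
          gamma2 alpha1 alpha2 alpha3 beta t
            = blockCv (Cmx alpha2 beta phi0 t) (alpha2 * t))) /\
  (alpha2 = 1 \/ alpha2 = -1 ->
     forall t : R,
       gamma2 alpha1 alpha2 alpha3 beta t = blockCv 1%:M (alpha2 * t)).
Proof.
have horE : 1 - alpha2 ^+ 2 = alpha3 ^+ 2 + alpha1 ^+ 2 by rewrite -Halpha; ring.
split=> [_|alpha2_unit t].
  split; first by rewrite horE; exact: polar_coordinates.
  move=> phi0 a1E a3E t; rewrite (CmxE _ _ _ _ _ _ Halpha a1E a3E).
  by split; [exact: geodesic3_in_SO21 | exact: gamma2E].
have /eqP : alpha3 ^+ 2 + alpha1 ^+ 2 = 0.
  by rewrite -horE; case: alpha2_unit => ->; ring.
rewrite paddr_eq0 ?sqr_ge0// !sqrf_eq0 => /andP[/eqP -> /eqP ->].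
rewrite /gamma2.
(* Rescaling time by beta turns the generator into the one with kappa = -1. *)
have -> : t *: (0 *: e1 + alpha2 *: e2 + 0 *: e3 + beta *: e4)
    = (t * beta) *: (0 *: e1 + 0 *: e3 + 1 *: e4) + (alpha2 * t) *: e2 :> 'M[R]_4.
  rewrite !scale0r scale1r add0r addr0 !add0r scalerDr !scalerA (mulrC t alpha2).
  exact: addrC.
rewrite mexp_so21 mexp_e4 blockCv_mul addr0.
have -> : 0 ^+ 2 + 0 ^+ 2 - 1 ^+ 2 = -1 :> R by ring.
rewrite !gsinN1 !gverN1 sinN cosN; congr blockCv; apply: mulmx1C.
by apply: quad_exp_mulN; rewrite sin2cos2; ring.
Qed.
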